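(* Let $q\in(0,1]$. The triangular $q$-Bernstein polynomials $B^n_{ijk}(u,v)$ (defined explicitly in the context) are given by each of the following two recurrences, with $B^0_{000}(u,v)=1$ and the convention $B^n_{ijk}(u,v)=0$ whenever one of the indices $i,j,k$ is negative. That is, for every integer $n\ge 1$ and all integers $i,j,k\ge 0$ with $i+j+k=n$, $$B_{ijk}^n(u,v)=u\,B_{i-1,j,k}^{n-1}(u,v)+v\,B_{i,j-1,k}^{n-1}(u,v)+(q^{i+j}-q^{n-1}u-q^{n-1}v)\,B_{i,j,k-1}^{n-1}(u,v)$$ and $$B_{ijk}^n(u,v)=q^k u\,B_{i-1,j,k}^{n-1}(u,v)+q^k v\,B_{i,j-1,k}^{n-1}(u,v)+(1-q^{k-1}u-q^{k-1}v)\,B_{i,j,k-1}^{n-1}(u,v),$$ as identities of polynomials in $u,v$.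
   Context: For a real number $q>0$ and a natural number $r$, the $q$-integer is $[r]=1+q+\cdots+q^{r-1}$ (so $[r]=\frac{1-q^r}{1-q}$ if $q\ne 1$, $[r]=r$ if $q=1$, and $[0]=0$). The $q$-factorial is $[r]!=[r][r-1]\cdots[1]$ with $[0]!=1$. The $q$-binomial coefficient is $\genfrac{[}{]}{0pt}{}{i}{j}=\frac{[i]!}{[j]!\,[i-j]!}$ if $i\ge j\ge 0$, and $0$ otherwise. For an integer $n\ge 0$ and integers $i,j,k\ge 0$ with $i+j+k=n$, the triangular $q$-Bernstein polynomial is $$B^n_{ijk}(u,v)=\genfrac{[}{]}{0pt}{}{n}{k}\binom{i+j}{i}u^iv^j\prod_{s=0}^{k-1}(1-q^su-q^sv),$$ where an empty product equals $1$. Here $u,v$ are real variables (the first two barycentric coordinates with respect to a triangle, the third being $1-u-v$). *)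

(* Defs.v *)
From mathcomp Require Export all_boot all_order all_algebra.
From mathcomp Require Export mpoly.
From mathcomp Require Export reals.

Set Implicit Arguments.
Unset Strict Implicit.
Unset Printing Implicit Defensive.

Import Order.TTheory GRing.Theory Num.Theory.
Local Open Scope ring_scope.

Notation "\u_ R" := ('X_0 : {mpoly R[2]}) (at level 0, R at level 2).
Notation "\v_ R" := ('X_1 : {mpoly R[2]}) (at level 0, R at level 2).

Definition qint (R : realType) (q : R) (r : nat) : R :=
  \sum_(s < r) q ^+ s.

Definition qfact (R : realType) (q : R) (r : nat) : R :=
  \prod_(1 <= s < r.+1) qint q s.

Definition qbin (R : realType) (q : R) (i j : nat) : R :=
  if (j <= i)%N then qfact q i / (qfact q j * qfact q (i - j)) else 0.

(* B^n_{ijk}(u, v). The indices are integers so that the convention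
   "B^n_{ijk} = 0 if one of i, j, k is negative" applies verbatim.  The
   value is only meaningful when i + j + k = n. *)
Definition qBernstein (R : realType) (q : R) (n : nat) (i j k : int) :
    {mpoly R[2]} :=
  match i, j, k with
  | Posz i, Posz j, Posz k =>
      (qbin q n k * 'C((i + j)%N, i)%:R) *:
        (\u_R ^+ i * \v_R ^+ j *
         \prod_(0 <= s < k) (1 - q ^+ s *: \u_R - q ^+ s *: \v_R))
  | _, _, _ => 0
  end.

(* Main.v *)
(* Both recurrences reduce to the two q-Pascal identities for [n choose k]: by
   the ordinary Pascal rule the u- and v-terms combine into
   [n-1 choose k] C(i+j, i) u^i v^j P_k with P_k = prod_(s < k) (1 - q^s(u+v)),
   while the last term completes P_(k-1) into P_k. *)
Require Import Defs.
From mathcomp Require Import ring.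

Import Order.TTheory GRing.Theory Num.Theory.
Local Open Scope ring_scope.

Lemma qint_gt0 (R : realType) (q : R) (r : nat) :
  0 < q -> 0 < qint q r.+1.
Proof.
move=> q_gt0; rewrite /qint big_ord_recl expr0 ltr_pwDl //.
by apply: sumr_ge0 => s _; rewrite exprn_ge0 ?ltW.
Qed.

Lemma qintD (R : realType) (q : R) (a b : nat) :
  qint q (a + b) = qint q a + q ^+ a * qint q b.
Proof.
rewrite /qint big_split_ord /= mulr_sumr; congr (_ + _).
by apply: eq_bigr => s _; rewrite exprD.
Qed.

Lemma qfact0 (R : realType) (q : R) : qfact q 0 = 1.
Proof. by rewrite /qfact big_nil. Qed.

Lemma qfactS (R : realType) (q : R) (r : nat) :
  qfact q r.+1 = qfact q r * qint q r.+1.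
Proof. by rewrite /qfact big_nat_recr. Qed.

Lemma qfact_neq0 (R : realType) (q : R) (r : nat) :
  0 < q -> qfact q r != 0.
Proof.
move=> q_gt0; elim: r => [|r IHr]; first by rewrite qfact0 oner_eq0.
by rewrite qfactS mulf_neq0 // gt_eqF // qint_gt0.
Qed.

(** Writing the upper index as [m + k] removes both the range test and the truncated subtraction
    from [qbin]. *)
Lemma qbinD (R : realType) (q : R) (m k : nat) :
  qbin q (m + k) k = qfact q (m + k) / (qfact q k * qfact q m).
Proof. by rewrite /qbin leq_addl addnK. Qed.

Lemma qbin_small (R : realType) (q : R) (n k : nat) :
  (n < k)%N -> qbin q n k = 0.
Proof. by move=> n_lt_k; rewrite /qbin leqNgt n_lt_k. Qed.

Lemma qbin0 (R : realType) (q : R) (n : nat) :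
  0 < q -> qbin q n 0 = 1.
Proof.
by move=> q_gt0; rewrite /qbin subn0 qfact0 mul1r divff // qfact_neq0.
Qed.

Lemma qbinn (R : realType) (q : R) (n : nat) :
  0 < q -> qbin q n n = 1.
Proof.
by move=> q_gt0; rewrite /qbin leqnn subnn qfact0 mulr1 divff // qfact_neq0.
Qed.

(** Over a common denominator this is the splitting $[m+k+1] = [m] + q^m [k+1]$ of the top factor of
    the numerator. *)
Lemma qbin_pascal_l (R : realType) (q : R) (m k : nat) : 0 < q ->
  qbin q (m + k).+1 k.+1 =
    qbin q (m + k) k.+1 + q ^+ m * qbin q (m + k) k.
Proof.
move=> q_gt0; case: m => [|m].
  (* For [m = 0] the first term is out of range, so it is the default value 0 and not a quotient of
     factorials. *)
  by rewrite add0n [qbin q k k.+1]qbin_small // !qbinn // add0r expr0 mul1r.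
(* One unit moves from [m.+1] to [k], giving the shape that [qbinD] expects. *)
have -> : qbin q (m.+1 + k) k.+1 = qfact q (m + k).+1 / (qfact q k.+1 * qfact q m).
  by rewrite addSnnS qbinD addnS.
rewrite -addnS !qbinD addnS addSn !qfactS.
have -> : qint q (m + k).+2 = qint q m.+1 + q ^+ m.+1 * qint q k.+1.
  by rewrite -qintD addSn addnS.
by field; rewrite !qfact_neq0 // !gt_eqF ?qint_gt0.
Qed.

(** Here the top factor is split in the other order: $[m+k+1] = [k+1] + q^{k+1} [m]$. *)
Lemma qbin_pascal_r (R : realType) (q : R) (m k : nat) : 0 < q ->
  qbin q (m + k).+1 k.+1 =
    q ^+ k.+1 * qbin q (m + k) k.+1 + qbin q (m + k) k.
Proof.
move=> q_gt0; case: m => [|m].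
  by rewrite add0n [qbin q k k.+1]qbin_small // !qbinn // mulr0 add0r.
have -> : qbin q (m.+1 + k) k.+1 = qfact q (m + k).+1 / (qfact q k.+1 * qfact q m).
  by rewrite addSnnS qbinD addnS.
rewrite -addnS !qbinD addnS addSn !qfactS.
have -> : qint q (m + k).+2 = qint q k.+1 + q ^+ k.+1 * qint q m.+1.
  by rewrite -qintD addSn addnS addnC.
by field; rewrite !qfact_neq0 // !gt_eqF ?qint_gt0.
Qed.

Lemma succz_sub1 (n : nat) : n.+1%:Z - 1 = n.
Proof. by rewrite intS addrC addKr. Qed.

(** Both terms carry the same [qbin q n k] and the same product, so only the ordinary Pascal rule
    for ['C(i + j, i)] is at stake. *)
Lemma qBernstein_uv (R : realType) (q : R) (n i j k : nat) :
  (i + j + k)%N = n.+1 ->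
  \u_R * qBernstein q n (i%:Z - 1) j k + \v_R * qBernstein q n i (j%:Z - 1) k =
  (qbin q n k * 'C(i + j, i)%:R) *:
    (\u_R ^+ i * \v_R ^+ j *
     \prod_(0 <= s < k) (1 - q ^+ s *: \u_R - q ^+ s *: \v_R)).
Proof.
case: i j => [|i] [|j] def_n; rewrite ?succz_sub1 /qBernstein /=.
(* Pascal's rule fails for $i = j = 0$, but then [k = n.+1], so [qbin q n k] vanishes. *)
- by rewrite !mulr0 addr0 qbin_small ?mul0r ?scale0r // -def_n.
- rewrite mulr0 add0r !add0n !bin0 -scalerAr; congr (_ *: _).
  by rewrite exprS; ring.
- rewrite mulr0 addr0 !addn0 !binn -scalerAr; congr (_ *: _).
  by rewrite exprS; ring.
(* [binS] puts first the summand that belongs to the [v]-term, hence the swap on the left. *)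
rewrite !addSn !addnS [in RHS]binS natrD mulrDr scalerDl [LHS]addrC -!scalerAr.
congr (_ *: _ + _ *: _); rewrite !exprS; ring.
Qed.

(** The linear form is exactly the factor [s = k] that extends the product by one. *)
Lemma qBernstein_w (R : realType) (q : R) (n i j k : nat) :
  (1 - q ^+ k *: \u_R - q ^+ k *: \v_R) * qBernstein q n i j k =
  (qbin q n k * 'C(i + j, i)%:R) *:
    (\u_R ^+ i * \v_R ^+ j *
     \prod_(0 <= s < k.+1) (1 - q ^+ s *: \u_R - q ^+ s *: \v_R)).
Proof.
rewrite /qBernstein -scalerAr big_nat_recr //=; congr (_ *: _).
by rewrite [LHS]mulrC [RHS]mulrA.
Qed.

Theorem proposition3p1 (R : realType) (q : R) (q_gt0 : 0 < q) (q_le1 : q <= 1) :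
  qBernstein q 0 0 0 0 = 1
  /\ (forall n i j k : nat, (1 <= n)%N -> (i + j + k)%N = n ->
        qBernstein q n i j k =
          \u_R * qBernstein q n.-1 (i%:Z - 1) j k
          + \v_R * qBernstein q n.-1 i (j%:Z - 1) k
          + ((q ^+ (i + j))%:MP - q ^+ n.-1 *: \u_R - q ^+ n.-1 *: \v_R)
            * qBernstein q n.-1 i j (k%:Z - 1))
  /\ (forall n i j k : nat, (1 <= n)%N -> (i + j + k)%N = n ->
        qBernstein q n i j k =
          (q ^+ k *: \u_R) * qBernstein q n.-1 (i%:Z - 1) j k
          + (q ^+ k *: \v_R) * qBernstein q n.-1 i (j%:Z - 1) k
          + (1 - q ^ (k%:Z - 1) *: \u_R - q ^ (k%:Z - 1) *: \v_R)
            * qBernstein q n.-1 i j (k%:Z - 1)).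
Proof.
split.
  rewrite /qBernstein /= qbin0 // bin0 mulr1 scale1r big_nil.
  by rewrite !expr0 !mulr1.
split=> -[//|n] i j [|k] _ def_n; rewrite [n.+1.-1]/=.
(* For [k = 0] the last term has a negative index, and [qbin] is 1 at both levels. *)
- rewrite qBernstein_uv // /qBernstein /= mulr0 addr0.
  by rewrite !qbin0.
- have def_n' : n = (i + j + k)%N by apply: succn_inj; rewrite -def_n addnS.
  (* Since $q^n = q^{i+j} q^k$, the power $q^{i+j}$ factors out; it is the weight in [qbin_pascal_l]
     with [m] equal to [i + j]. *)
  have -> : (q ^+ (i + j))%:MP - q ^+ n *: \u_R - q ^+ n *: \v_R =
            q ^+ (i + j) *: (1 - q ^+ k *: \u_R - q ^+ k *: \v_R).
    by rewrite def_n' !scalerBr !scalerA -exprD alg_mpolyC.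
  rewrite qBernstein_uv // succz_sub1 -scalerAl qBernstein_w scalerA -scalerDl.
  by rewrite mulrA -mulrDl def_n' -qbin_pascal_l.
(* For [k = 0] the coefficients $q^{-1}$ only multiply a polynomial that is 0 by convention. *)
- rewrite -!scalerAl -scalerDr qBernstein_uv // /qBernstein /= mulr0 addr0.
  by rewrite expr0 scale1r !qbin0.
have def_n' : n = (i + j + k)%N by apply: succn_inj; rewrite -def_n addnS.
(* The integer exponent [k.+1 - 1] becomes the natural [k], so that the linear form matches
   [qBernstein_w]. *)
rewrite -!scalerAl -scalerDr qBernstein_uv // succz_sub1 -exprnP qBernstein_w.
by rewrite scalerA -scalerDl mulrA -mulrDl def_n' -qbin_pascal_r.
Qed.
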